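(* Let $S=\{u_1,\ldots,u_k\}\subseteq\mathbb{R}^n$ be a set of $k$ points with $k>n+1$, and let $\hat S=\{\omega(u_1),\ldots,\omega(u_k)\}\subseteq\mathbb{R}^{k-1}$. Suppose the $(k-1)\times(k-1)$ matrix $$L=\big[\,\omega(u_1)-\omega(u_k)\ \ \cdots\ \ \omega(u_{k-1})-\omega(u_k)\,\big]$$ is nonsingular. Then the function $$\hat f(z)=F_{k-1}\big(L^{-1}(z-\omega(u_k))\big),\qquad z\in\mathbb{R}^{k-1},$$ is a loss function for $\hat S$ and it has no spurious minimizers.
   Context: $\mathbb{B}_0\subseteq\mathbb{N}^n$ is the set of the first $k$ vectors of $\mathbb{N}^n$ ($\mathbb{N}$ includes $0$) in the graded lexicographic ordering $0,e_1,\ldots,e_n,2e_1,e_1+e_2,\ldots$ (that is, $\alpha$ comes before $\beta$ if $|\alpha|<|\beta|$, or if $|\alpha|=|\beta|$ and the leftmost nonzero entry of $\alpha-\beta$ is positive, where $|\alpha|=\alpha_1+\cdots+\alpha_n$). $[x]_{\mathbb{B}_0}=(x^\alpha)_{\alpha\in\mathbb{B}_0}$ is the column vector of the corresponding monomials, and $\omega:\mathbb{R}^n\to\mathbb{R}^{k-1}$ is the map defined by $$[x]_{\mathbb{B}_0}=\begin{bmatrix}1\\ \omega(x)\end{bmatrix},$$ i.e. $\omega(x)$ lists the monomials $x^\alpha$ with $\alpha\in\mathbb{B}_0\setminus\{0\}$. For $z=(z_1,\ldots,z_{k-1})\in\mathbb{R}^{k-1}$, $$F_{k-1}(z)=\sum_{i=1}^{k-1}z_i^2(z_i-1)^2+\sum_{1\le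 i<j\le k-1}z_i^2z_j^2.$$ A function $f$ on $\mathbb{R}^m$ is a loss function for a set $A\subseteq\mathbb{R}^m$ if the global minimizers of $f$ are precisely the points of $A$; loss functions are here normalized to be nonnegative with minimum value zero, so this means $f\ge0$ on $\mathbb{R}^m$ and $f(x)=0$ if and only if $x\in A$. A spurious minimizer is a local minimizer that is not a global minimizer. *)

(* Defs.v *)
From HB Require Import structures.
From mathcomp Require Import all_boot all_order all_algebra.
From mathcomp Require Import all_classical all_reals all_analysis.
Set Implicit Arguments.
Unset Strict Implicit.
Unset Printing Implicit Defensive.
Import Order.TTheory GRing.Theory Num.Theory.
Import numFieldNormedType.Exports.
Local Open Scope classical_set_scope.
Local Open Scope ring_scope.

Section GradedLex.
Local Open Scope nat_scope.

Definition mdegree n (a : {ffun 'I_n -> nat}) : nat := \sum_(i < n) a i.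

Definition grlex_lt n (a b : {ffun 'I_n -> nat}) : bool :=
  (mdegree a < mdegree b) ||
  (mdegree a == mdegree b) &&
  [exists i : 'I_n,
    [forall j : 'I_n, (j < i) ==> (a j == b j)] && (b i < a i)].

Definition grlex_le n (a b : {ffun 'I_n -> nat}) : bool :=
  (a == b) || grlex_lt a b.

(* The exponent vectors of degree less than [k] form an initial segment of
   the graded lexicographic order, with at least [k] elements when n > 0. *)
Definition grlex_below n k : seq {ffun 'I_n -> nat} :=
  [seq a <- [seq [ffun i => nat_of_ord (c i)] | c : {ffun 'I_n -> 'I_k}]
     | mdegree a < k].

Definition grlex_first n k : seq {ffun 'I_n -> nat} :=
  take k (sort (@grlex_le n) (grlex_below n k)).

Lemma grlex_lt_irr n : irreflexive (@grlex_lt n).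
Proof.
move=> a; rewrite /grlex_lt ltnn eqxx /=; apply/existsP => -[i].
by rewrite ltnn andbF.
Qed.

Lemma grlex_lt_trans n : transitive (@grlex_lt n).
Proof.
move=> b a c; rewrite /grlex_lt.
case/orP=> [ab|/andP[/eqP-> /existsP[i /andP[/forallP abi bai]]]].
  case/orP=> [bc|/andP[/eqP<- _]]; last by rewrite ab.
  by rewrite (ltn_trans ab bc).
case/orP=> [->//|/andP[-> /existsP[j /andP[/forallP bcj cbj]]]].
apply/orP; right => /=.
case: (ltngtP i j) => ij.
- apply/existsP; exists i; apply/andP; split.
    apply/forallP => l; apply/implyP => li.
    rewrite (eqP (implyP (abi l) li)).
    exact: (implyP (bcj l) (ltn_trans li ij)).
  by rewrite -(eqP (implyP (bcj i) ij)).
- apply/existsP; exists j; apply/andP; split.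
    apply/forallP => l; apply/implyP => lj.
    rewrite -(eqP (implyP (bcj l) lj)).
    exact: (implyP (abi l) (ltn_trans lj ij)).
  by rewrite (eqP (implyP (abi j) ij)).
- apply/existsP; exists i; apply/andP; split.
    apply/forallP => l; apply/implyP => li.
    rewrite (eqP (implyP (abi l) li)).
    by apply: (implyP (bcj l)); rewrite -ij.
  by apply: ltn_trans bai; have -> : i = j by exact: val_inj.
Qed.

Lemma grlex_le_trans n : transitive (@grlex_le n).
Proof.
move=> b a c; rewrite /grlex_le.
case/orP=> [/eqP->//|ab] /orP[/eqP<-|bc]; first by rewrite ab orbT.
by rewrite (grlex_lt_trans ab bc) orbT.
Qed.

Lemma grlex_le_total n : total (@grlex_le n).
Proof.
move=> a b; rewrite /grlex_le eq_sym /grlex_lt.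
have [//|ba /=] := eqVneq b a.
have [//|//|dab /=] := ltngtP (mdegree a) (mdegree b).
have /existsP[i0 di0] : [exists i, a i != b i].
  apply: contraR ba; rewrite negb_exists => /forallP h.
  by apply/eqP/ffunP => i; apply/esym/eqP; rewrite -[_ == _]negbK.
have di0' : [pred i | a i != b i] i0 by [].
case: (arg_minnP (fun i : 'I_n => i : nat) di0') => /= i di min_i.
have eqi (j : 'I_n) : j < i -> a j == b j.
  by move=> ji; apply: contraLR ji => /min_i; rewrite -leqNgt.
have [lab|lba|eab] := ltngtP (a i) (b i); last by rewrite eab eqxx in di.
- apply/orP; right; apply/existsP; exists i; rewrite lab andbT.
  by apply/forallP => j; apply/implyP => /eqi; rewrite eq_sym.
- apply/orP; left; apply/existsP; exists i; rewrite lba andbT.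
  by apply/forallP => j; apply/implyP => /eqi.
Qed.

Lemma grlex_belowE n k (a : {ffun 'I_n -> nat}) :
  (a \in grlex_below n k) = (mdegree a < k).
Proof.
rewrite mem_filter andb_idr // => ak.
have lt_k i : a i < k.
  by apply: leq_ltn_trans ak; rewrite /mdegree (bigD1 i) //= leq_addr.
apply/mapP; exists [ffun i => Ordinal (lt_k i)]; first by rewrite mem_enum.
by apply/ffunP => i; rewrite !ffunE.
Qed.

Lemma grlex_below_uniq n k : uniq (grlex_below n k).
Proof.
apply: filter_uniq; rewrite map_inj_uniq ?enum_uniq // => c d cd.
by apply/ffunP => i; apply: val_inj; move/ffunP: cd => /(_ i); rewrite !ffunE.
Qed.

Lemma size_grlex_first n k : size (grlex_first n.+1 k) = k.
Proof.
rewrite size_takel // size_sort.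
pose e (j : nat) : {ffun 'I_n.+1 -> nat} := [ffun i => (i == ord0) * j].
have degE j : mdegree (e j) = j.
  rewrite /mdegree (bigD1 ord0) //= ffunE eqxx mul1n big1 ?addn0 // => i i0.
  by rewrite ffunE (negbTE i0).
rewrite -{1}(size_iota 0 k) -(size_map e); apply: uniq_leq_size.
  rewrite map_inj_uniq ?iota_uniq // => i j /(congr1 (@mdegree _)).
  by rewrite !degE.
by move=> _ /mapP[j + ->]; rewrite mem_iota add0n grlex_belowE degE.
Qed.

Lemma grlex_first_sorted n k : sorted (@grlex_lt n) (grlex_first n k).
Proof.
apply: take_sorted.
have := sort_sorted (@grlex_le_total n) (grlex_below n k).
have : uniq (sort (@grlex_le n) (grlex_below n k)).
  by rewrite sort_uniq grlex_below_uniq.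
case: (sort _ _) => //= x s; elim: s x => //= y s IH x.
rewrite inE negb_or -!andbA => /and4P[xy _ ys us] /andP[le_xy ps].
by move: le_xy; rewrite /grlex_le (negbTE xy) /= => ->; apply: IH; rewrite ?ys.
Qed.

Lemma grlex_first_initial n k (a b : {ffun 'I_n -> nat}) :
  b \in grlex_first n k -> grlex_lt a b -> a \in grlex_first n k.
Proof.
rewrite /grlex_first; set s := sort _ _ => bk ab.
have sb : b \in s by exact: mem_take bk.
have sa : a \in s.
  move: sb; rewrite !mem_sort !grlex_belowE; apply: leq_ltn_trans.
  by case/orP: ab => [/ltnW|/andP[/eqP->]].
have [//|ak] := boolP (a \in take k s).
have ad : a \in drop k s
  by move: sa; rewrite -{1}(cat_take_drop k s) mem_cat (negbTE ak).
have ss : sorted (@grlex_le n) s by exact: sort_sorted (@grlex_le_total n) _.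
move: ss; rewrite -(cat_take_drop k s) (sorted_pairwise (@grlex_le_trans n)).
rewrite pairwise_cat => /andP[/allrelP/(_ b a bk ad) + _].
case/orP=> [/eqP ba|ba]; first by rewrite -ba grlex_lt_irr in ab.
by have := grlex_lt_trans ab ba; rewrite grlex_lt_irr.
Qed.

Lemma grlex_first_head n k :
  nth [ffun=> 0] (grlex_first n k) 0 = [ffun=> 0] :> {ffun 'I_n -> nat}.
Proof.
case: k => [|k]; first by rewrite /grlex_first take0.
have h0 : [ffun=> 0] \in sort (@grlex_le n) (grlex_below n k.+1).
  by rewrite mem_sort grlex_belowE /mdegree big1 // => l _; rewrite ffunE.
rewrite /grlex_first.
case: (sort _ _) h0
  (sort_sorted (@grlex_le_total n) (grlex_below n k.+1)) => //= c s.
rewrite inE => /predU1P[//|zs].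
move/(order_path_min (@grlex_le_trans n))/allP/(_ _ zs)/orP.
have mz : mdegree ([ffun=> 0] : {ffun 'I_n -> nat}) = 0.
  by rewrite /mdegree big1 // => l _; rewrite ffunE.
case=> [/eqP//|]; rewrite /grlex_lt mz ltn0 /=.
case/andP=> /eqP; rewrite /mdegree => /eqP; rewrite sum_nat_eq0 => /forallP c0 _.
by apply/ffunP => l; rewrite ffunE; apply/eqP; exact: c0.
Qed.

End GradedLex.

Section Omega.
Variable R : realType.

(* The default exponent is only reached when n = 0 and i > 0: then there are
   fewer than k exponent vectors. *)
Definition grlex_nth n k (i : 'I_k) : {ffun 'I_n -> nat} :=
  nth [ffun=> 0%N] (grlex_first n k) i.

Definition monomial n (a : {ffun 'I_n -> nat}) (x : 'cV[R]_n) : R :=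
  \prod_(i < n) x i 0 ^+ a i.

Definition monomials n k (x : 'cV[R]_n) : 'cV[R]_k :=
  \col_(i < k) monomial (grlex_nth n i) x.

Definition omega n m (x : 'cV[R]_n) : 'cV[R]_m :=
  dsubmx (monomials (1 + m) x).

Lemma monomialsE n m (x : 'cV[R]_n) :
  monomials (1 + m) x = col_mx 1%:M (omega m x).
Proof.
rewrite -[LHS]vsubmxK; congr col_mx; apply/colP => i.
rewrite !mxE !ord1 eqxx mulr1n /monomial big1 // => j _.
by rewrite /grlex_nth grlex_first_head ffunE expr0.
Qed.

End Omega.

Section Minimizers.
Variables (R : realType) (m : nat).
Implicit Types (f : 'cV[R]_m -> R) (x : 'cV[R]_m) (A : set 'cV[R]_m).

Definition is_loss_function f A : Prop :=
  (forall x, 0 <= f x) /\ (forall x, f x = 0 <-> A x).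

Definition global_minimizer f x : Prop := forall y, f x <= f y.

Definition local_minimizer f x : Prop := \forall y \near x, f x <= f y.

Definition spurious_minimizer f x : Prop :=
  local_minimizer f x /\ ~ global_minimizer f x.

End Minimizers.

Section Loss.
Variable R : realType.

Definition lossF m (z : 'cV[R]_m) : R :=
  \sum_(i < m) z i 0 ^+ 2 * (z i 0 - 1) ^+ 2
  + \sum_(i < m) \sum_(j < m | (i < j)%N) z i 0 ^+ 2 * z j 0 ^+ 2.

(* The points are numbered 0, ..., m, so [lift ord_max j] runs over all the
   indices but the last. *)
Definition differences n m (u : 'I_m.+1 -> 'cV[R]_n) : 'M[R]_m :=
  \matrix_(i < m, j < m)
    (omega m (u (lift ord_max j)) - omega m (u ord_max)) i 0.

Definition lossF_hat n m (u : 'I_m.+1 -> 'cV[R]_n) (z : 'cV[R]_m) : R :=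
  lossF (invmx (differences u) *m (z - omega m (u ord_max))).

End Loss.

(* Main.v *)
(** Along the line [z + h e_i], [F] varies as [t^2 ((t - 1)^2 + s)] with
    [t = z_i + h] and [s] the sum of the other squares.  If [t = z_i] is a
    local minimizer of this quartic, then [t = 0], or [2t^2 - 3t + 1 + s = 0]
    and [4t^2 - 3t >= 0], hence [t >= 3/4] and [s <= 1/8].  Two nonzero
    coordinates would give [s >= 9/16], so a point that is locally minimal
    along each axis is [0] or some [e_i], where [F] vanishes.  The affine map
    [w |-> L w + omega(u_k)] sends [e_i] to [omega(u_i)] and [0] to
    [omega(u_k)]. *)
Require Import Defs.
From mathcomp Require Import all_boot all_order all_algebra.
From mathcomp Require Import all_classical all_reals all_analysis.
From mathcomp Require Import ring lra.
Import Order.TTheory GRing.Theory Num.Theory.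
Import numFieldNormedType.Exports.
Local Open Scope classical_set_scope.
Local Open Scope ring_scope.

(** Lets an inequality for small [h > 0], once divided by [h], pass to the limit at 0. *)
Lemma continuous_right_ge0 (R : realType) (q : R -> R) :
  {for 0, continuous q} -> (\forall h \near 0^'+, 0 <= q h) -> 0 <= q 0.
Proof.
move=> qc q0; have qr : q h @[h --> 0^'+] --> q 0 by exact: cvg_at_right_filter.
by rewrite -(cvg_lim _ qr)//; apply: limr_ge => //; apply/cvg_ex; exists (q 0).
Qed.

Lemma quartic_local_min (R : realType) (t s : R) : 0 <= s ->
  (\forall h \near 0,
     t ^+ 2 * ((t - 1) ^+ 2 + s) <= (t + h) ^+ 2 * ((t + h - 1) ^+ 2 + s)) ->
  t = 0 \/ 2 * t ^+ 2 - 3 * t + 1 + s = 0 /\ 3 / 4 <= t.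
Proof.
move=> s0 tmin.
(* Taylor coefficients at [t] of the quartic: its derivative, half its second derivative and a sixth
   of its third. *)
pose a : R := 2 * t * (2 * t ^+ 2 - 3 * t + 1 + s).
pose b : R := 6 * t ^+ 2 - 6 * t + 1 + s.
pose c : R := 4 * t - 2.
have expand h : (t + h) ^+ 2 * ((t + h - 1) ^+ 2 + s) =
    t ^+ 2 * ((t - 1) ^+ 2 + s) + h * (a + h * (b + h * (c + h))).
  by rewrite /a /b /c; ring.
have hmin : \forall h \near (0 : R), 0 <= h * (a + h * (b + h * (c + h))).
  by apply: filterS tmin => h; rewrite expand lerDl.
have contC (k : R) (f : R -> R) :
    continuous f -> continuous (fun h : R => k + h * f h).
  move=> fc x; apply: cvgD; first exact: cvg_cst.
  by apply: cvgM; [exact: cvg_id|exact: fc].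
have c1 : continuous (fun h : R => c + h).
  by move=> x; apply: cvgD; [exact: cvg_cst|exact: cvg_id].
have a_ge0 : 0 <= a.
  have := @continuous_right_ge0 R (fun h : R => a + h * (b + h * (c + h))).
  rewrite mul0r addr0; apply; first by do 2 apply/contC.
  near=> h; have h0 : 0 < h by near: h; exact: nbhs_right_gt.
  rewrite -(pmulr_rge0 _ h0); near: h; exact: cvg_within.
(* Increments [- h] with [h > 0] give the opposite sign. *)
have a_le0 : a <= 0.
  pose q (h : R) : R := a + h * (b + h * (c + h)).
  have {}hmin : \forall h \near (0 : R), 0 <= - h * q (- h).
    by move: hmin; rewrite -{1}oppr0 nearN.
  rewrite -oppr_ge0.
  have := @continuous_right_ge0 R (fun h : R => - q (- h)).
  have q0 : q 0 = a by rewrite /q mul0r addr0.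
  rewrite oppr0 q0; apply.
    apply: cvgN; apply: (@continuous_comp _ _ _ -%R q).
      exact: oppr_continuous.
    by do 2 apply/contC.
  near=> h; have h0 : 0 < h by near: h; exact: nbhs_right_gt.
  rewrite -(pmulr_rge0 _ h0) mulrN -mulNr; near: h; exact: cvg_within.
have a0 : a = 0 by apply/eqP; rewrite eq_le a_le0.
(* As [a = 0], the increment has a factor [h ^+ 2], which is divided out. *)
have b_ge0 : 0 <= b.
  have {}hmin : \forall h \near (0 : R), 0 <= h * (h * (b + h * (c + h))).
    by apply: filterS hmin => h; rewrite a0 add0r.
  have := @continuous_right_ge0 R (fun h : R => b + h * (c + h)).
  rewrite mul0r addr0; apply; first by apply/contC.
  near=> h; have h0 : 0 < h by near: h; exact: nbhs_right_gt.
  rewrite -(pmulr_rge0 _ h0) -(pmulr_rge0 _ h0).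
  near: h; exact: cvg_within.
have [->|t0] := eqVneq t 0; [by left|right].
have root_t : 2 * t ^+ 2 - 3 * t + 1 + s = 0.
  apply/eqP; move/eqP: a0.
  by rewrite /a mulf_eq0 (mulf_eq0 2) (negbTE t0) pnatr_eq0.
(* The root equation gives [3 * t = 2 * t ^+ 2 + 1 + s > 0]; subtracting it from [b >= 0] leaves
   [4 * t ^+ 2 - 3 * t >= 0], to be divided by [t]. *)
split=> //; have t_gt0 : 0 < t by nra.
by rewrite -(ler_pM2l t_gt0); move: b_ge0 root_t; rewrite /b; lra.
Unshelve. all: by end_near.
Qed.

Section Loss.
Variables (R : realType) (m : nat).
Implicit Types (z : 'cV[R]_m) (i : 'I_m).

(** The square of the sum is the diagonal plus two triangular sums, equal by symmetry. This frees
    [lossF] from the order of the indices, so that any coordinate can be singled out. *)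
Lemma sum_lt_mul (a : 'I_m -> R) :
  \sum_(i < m) \sum_(j < m | (i < j)%N) a i * a j =
  ((\sum_i a i) ^+ 2 - \sum_i a i ^+ 2) / 2.
Proof.
set T := LHS.
suff -> : (\sum_i a i) ^+ 2 = T + T + \sum_i a i ^+ 2 by field.
have {2}-> : T = \sum_(i < m) \sum_(j < m | (j < i)%N) a i * a j.
  rewrite /T (exchange_big_dep predT)//=.
  by apply: eq_bigr => i _; apply: eq_bigr => j _; rewrite mulrC.
rewrite -!big_split expr2 big_distrlr /=; apply: eq_bigr => i _.
rewrite (bigID (fun j : 'I_m => (i < j)%N)) /= -addrA; congr (_ + _).
rewrite (bigD1 i) ?ltnn//= addrC expr2; congr (_ + _).
apply: eq_bigl => j; rewrite -leqNgt [in RHS]ltn_neqAle andbC.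
by congr (_ && _).
Qed.

Lemma lossF_sqr_sum z :
  lossF z = \sum_i z i 0 ^+ 2 * (z i 0 - 1) ^+ 2 +
    ((\sum_i z i 0 ^+ 2) ^+ 2 - \sum_i (z i 0 ^+ 2) ^+ 2) / 2.
Proof. by rewrite /lossF (sum_lt_mul (fun i => z i 0 ^+ 2)). Qed.

Lemma lossF_ge0 z : 0 <= lossF z.
Proof.
apply: addr_ge0; apply: sumr_ge0 => i _; first by rewrite mulr_ge0 ?sqr_ge0.
by apply: sumr_ge0 => j _; rewrite mulr_ge0 ?sqr_ge0.
Qed.

Definition lossF_slice z i (t : R) : R :=
  t ^+ 2 * ((t - 1) ^+ 2 + \sum_(j | j != i) z j 0 ^+ 2).

Lemma lossF_line z i (h : R) :
  lossF (z + h *: delta_mx i 0) =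
  lossF z + (lossF_slice z i (z i 0 + h) - lossF_slice z i (z i 0)).
Proof.
have zi : (z + h *: delta_mx i 0) i 0 = z i 0 + h.
  by rewrite !mxE !eqxx mulr1.
have zj j : j != i -> (z + h *: delta_mx i 0) j 0 = z j 0.
  by move=> ji; rewrite !mxE (negbTE ji) mulr0 addr0.
have sumE (f : R -> R) : \sum_j f ((z + h *: delta_mx i 0) j 0) =
    f (z i 0 + h) + \sum_(j | j != i) f (z j 0).
  by rewrite (bigD1 i)//= zi; congr (_ + _); apply: eq_bigr => j /zj ->.
rewrite !lossF_sqr_sum /lossF_slice.
rewrite (sumE (fun x => x ^+ 2 * (x - 1) ^+ 2)) (sumE (fun x => x ^+ 2)).
rewrite (sumE (fun x => (x ^+ 2) ^+ 2)) !(bigD1 i (P := predT))//=.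
by field.
Qed.

Lemma lossF0 : lossF (0 : 'cV[R]_m) = 0.
Proof.
by rewrite lossF_sqr_sum !big1 ?expr0n ?subrr ?mul0r ?addr0// => i _;
  rewrite mxE expr0n ?mul0r ?expr0n.
Qed.

Lemma lossF_delta i : lossF (delta_mx i 0 : 'cV[R]_m) = 0.
Proof.
(* Through the origin the slice is [t ^+ 2 * (t - 1) ^+ 2], zero at both 0 and 1. *)
have := lossF_line 0 i 1; rewrite add0r scale1r lossF0 => ->.
rewrite /lossF_slice big1 => [|j _]; last by rewrite mxE expr0n.
by rewrite mxE; ring.
Qed.

(** Minimality along the axes alone is assumed, so that this serves both for the zeros of [lossF]
    and for the local minimizers of [lossF_hat]. *)
Lemma lossF_axis_local_min z :
  (forall i, \forall h \near (0 : R),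
     lossF z <= lossF (z + h *: delta_mx i 0)) ->
  z = 0 \/ exists i, z = delta_mx i 0.
Proof.
move=> zmin.
have s_ge0 i : 0 <= \sum_(j | j != i) z j 0 ^+ 2.
  by apply: sumr_ge0 => j _; exact: sqr_ge0.
have zP i : z i 0 = 0 \/
    2 * z i 0 ^+ 2 - 3 * z i 0 + 1 + \sum_(j | j != i) z j 0 ^+ 2 = 0 /\
    3 / 4 <= z i 0.
  apply: quartic_local_min => //; apply: filterS (zmin i) => h.
  by rewrite lossF_line lerDl subr_ge0.
have [/forallP z0|] := boolP [forall i, z i 0 == 0].
  by left; apply/colP => i; rewrite mxE; exact/eqP.
rewrite negb_forall => /existsP[i zi0]; right; exists i.
have [zi|[root_i zi_ge]] := zP i; first by rewrite zi eqxx in zi0.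
have zj0 j : j != i -> z j 0 = 0.
  move=> ji; have [//|[_ zj_ge]] := zP j.
  have : z j 0 ^+ 2 <= \sum_(j | j != i) z j 0 ^+ 2.
    rewrite (bigD1 j)//= lerDl; apply: sumr_ge0 => l _; exact: sqr_ge0.
  (* This square bounds [2 * t ^+ 2 - 3 * t] below by -9/8, so the root equation forces [s <= 1/8],
     against [s >= 9/16]. *)
  have := sqr_ge0 (4 * z i 0 - 3).
  have : (3 / 4) ^+ 2 <= z j 0 ^+ 2 by rewrite ler_sqr ?nnegrE//; lra.
  by move: root_i; set s := \sum_(_ | _) _; lra.
move: root_i; rewrite big1 => [root_i|j ji]; last by rewrite zj0// expr0n.
(* With [s = 0] the roots are 1/2 and 1, and the bound 3/4 excludes the first. *)
have /eqP : (2 * z i 0 - 1) * (z i 0 - 1) = 0 by rewrite -root_i; ring.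
rewrite mulf_eq0 => /orP[/eqP zi2|/eqP zi1].
  by exfalso; move: zi2 zi_ge; clear; lra.
apply/colP => j; rewrite mxE eqxx andbT.
by have [->|/zj0//] := eqVneq j i; exact/subr0_eq.
Qed.

Lemma lossF_eq0 z : lossF z = 0 <-> z = 0 \/ exists i, z = delta_mx i 0.
Proof.
split=> [z0|[->|[i ->]]]; [|exact: lossF0|exact: lossF_delta].
apply: lossF_axis_local_min => i; apply: filterE => h.
by rewrite z0 lossF_ge0.
Qed.

End Loss.

Lemma lossF_hat_local_min_eq0 (R : realType) (n m : nat)
    (u : 'I_m.+1 -> 'cV[R]_n) (z : 'cV[R]_m) :
  differences u \in unitmx -> local_minimizer (lossF_hat u) z ->
  lossF_hat u z = 0.
Proof.
move=> uL zmin; apply/lossF_eq0/lossF_axis_local_min => i.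
(* The inverse matrix sends [v] to the basis vector, so moving [z] along [v] moves the argument of
   [lossF] along an axis. *)
pose v : 'cV[R]_m := differences u *m delta_mx i 0.
have line : z + h *: v @[h --> (0 : R)] --> z.
  rewrite -[X in _ --> X]addr0 -(scale0r v).
  by apply: cvgD; [exact: cvg_cst|apply: cvgZl; exact: cvg_id].
have := line _ zmin; rewrite near_simpl near_map; apply: filterS => h /=.
by rewrite /lossF_hat addrAC (mulmxDr _ (z - _)) -scalemxAr mulKmx.
Qed.

Theorem theorem4p3 (R : realType) (n m : nat) (u : 'I_m.+1 -> 'cV[R]_n)
    (hk : (n + 1 < m.+1)%N) (hu : injective u)
    (hL : differences u \in unitmx) :
  is_loss_function (lossF_hat u) (omega m @` range u) /\
  ~ (exists z : 'cV[R]_m, spurious_minimizer (lossF_hat u) z).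
Proof.
split; last first.
  (* The value at a local minimizer is 0, a lower bound of [lossF_hat u]. *)
  move=> [z [zmin]]; apply=> y.
  by rewrite (lossF_hat_local_min_eq0 _ _ _ _ _ hL zmin) lossF_ge0.
split=> z; first exact: lossF_ge0.
have deltaE j : differences u *m delta_mx j 0 =
    omega m (u (lift ord_max j)) - omega m (u ord_max).
  by rewrite -colE; apply/colP => i; rewrite !mxE.
rewrite /lossF_hat lossF_eq0; split.
  (* Multiplying by [differences u] solves for [z] at each zero of [lossF]. *)
  move=> zE; have {zE} : z - omega m (u ord_max) = 0 \/
      exists j, z - omega m (u ord_max) = differences u *m delta_mx j 0.
    by case: zE => [|[j]] /(congr1 (mulmx (differences u)));
      rewrite mulKVmx// ?mulmx0; [left|right; exists j].
  move=> [/subr0_eq ->|[j]]; first by exists (u ord_max) => //; exists ord_max.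
  rewrite deltaE => /addIr ->.
  by exists (u (lift ord_max j)) => //; exists (lift ord_max j).
move=> [_ [i _ <-] <-]; case: (unliftP ord_max i) => [j|] ->.
  by right; exists j; rewrite -deltaE mulKmx.
by left; rewrite subrr mulmx0.
Qed.
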